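(* Every Baire weakly Moran space is a Namioka space.
   Context: A topological space is Baire if every countable intersection of dense open sets is dense. A function $f:X\times Y\to\mathbb R$ on a product of topological spaces is separately continuous if it is continuous in each variable when the other is fixed. For a topological space $P$, a function $f:P\to\mathbb R$ is of Baire class $0$ if it is continuous, and for an at most countable ordinal $\alpha\ge1$ it is of Baire class $\alpha$ if it is the pointwise limit of a sequence of functions $P\to\mathbb R$ each of Baire class $<\alpha$; $f$ is Baire measurable if it is of Baire class $\alpha$ for some at most countable ordinal $\alpha$. A topological space $X$ is a weakly Moran space if for every compact space $Y$ each separately continuous function $f:X\times Y\to\mathbb R$ is Baire measurable (on $X\times Y$ with the product topology). A function $f:X\times Y\to\mathbb R$ has the Namioka property if there exists a dense $G_\delta$-set $A\subseteq X$ such that $f$ is jointly continuous at every point of $A\times Y$. A topological space $X$ is a Namioka space if for every compact space $Y$ each separately continuous function $f:X\times Y\to\mathbb R$ has the Namioka property. *)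

(* Defs.v *)
From HB Require Import structures.
From mathcomp Require Import all_boot all_order all_algebra.
From mathcomp Require Import all_classical all_reals all_analysis.
From mathcomp Require Import borel_hierarchy.

Set Implicit Arguments.
Unset Strict Implicit.
Unset Printing Implicit Defensive.

Import Order.TTheory GRing.Theory Num.Theory.
Import numFieldNormedType.Exports.

Local Open Scope classical_set_scope.
Local Open Scope ring_scope.

Definition baire_space (X : topologicalType) : Prop :=
  forall U : nat -> set X,
    (forall n, open (U n) /\ dense (U n)) -> dense (\bigcap_n U n).

Definition separately_continuous (R : realType) (X Y : topologicalType)
    (f : X * Y -> R) : Prop :=
  (forall x, continuous (fun y => f (x, y))) /\
  (forall y, continuous (fun x => f (x, y))).

(* The ordinal indexing the class is the order type of the strict initial
   segment [b < a] of a well-ordered type [W]: the least element of [W] stands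
   for 0, and any other element for an ordinal >= 1. *)
Inductive baire_class (R : realType) (P : topologicalType)
    (d : Order.disp_t) (W : orderType d) : W -> (P -> R) -> Prop :=
| baire_class_continuous (a : W) (f : P -> R) :
    (forall b : W, (a <= b)%O) -> continuous f -> baire_class a f
| baire_class_lim (a : W) (f : P -> R) (b : nat -> W) (g : nat -> P -> R) :
    (forall n, (b n < a)%O) -> (forall n, baire_class (b n) (g n)) ->
    (forall p, (fun n => g n p) @ \oo --> f p) ->
    baire_class a f.

(* The at most countable ordinals are exactly the order types of the strict
   initial segments of countable well-orders. *)
Definition baire_measurable (R : realType) (P : topologicalType)
    (f : P -> R) : Prop :=
  exists (d : Order.disp_t) (W : orderType d) (a : W),
    [/\ well_founded (fun x y : W => (x < y)%O), countable [set: W]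
      & baire_class a f].

(* Compact spaces are not required to be Hausdorff, here and in
   [namioka_space]; passing to the image of [Y] in [X -> R] shows that requiring
   it would define the same notions. *)
Definition weakly_moran (R : realType) (X : topologicalType) : Prop :=
  forall Y : topologicalType, compact [set: Y] ->
  forall f : X * Y -> R, separately_continuous f -> baire_measurable f.

Definition namioka_property (R : realType) (X Y : topologicalType)
    (f : X * Y -> R) : Prop :=
  exists A : set X, [/\ dense A, Gdelta A &
    forall x y, A x -> {for (x, y), continuous f}].

Definition namioka_space (R : realType) (X : topologicalType) : Prop :=
  forall Y : topologicalType, compact [set: Y] ->
  forall f : X * Y -> R, separately_continuous f -> namioka_property f.

(* Main.v *)
Require Import Defs.
From mathcomp Require Import all_boot all_order all_algebra.
From mathcomp Require Import all_classical all_reals all_analysis.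
From mathcomp Require Import borel_hierarchy lra.

(** Being determined by countably many continuous functions (equality of all
    their values at two points forces equality of [f] there) passes from the
    terms of a sequence to its pointwise limit, so every Baire measurable
    function [f] on [X * Y] is determined by continuous functions [h 0], [h 1],
    and so on ([baire_measurable_determined]).  This is all that Baire
    measurability contributes.

    Fix [e > 0] and call [x] good at level [j] when two points [y], [y'] of [Y]
    at which each of [h 0 (x, -)], ..., [h j (x, -)] varies by less than
    [1 / (j + 1)] are points between which [f (x, -)] varies by at most [e].
    Since [Y] is compact and [f (x, -)] is a continuous function determined by
    the [h i (x, -)], every [x] is good at some level
    ([compact_determined_ucontinuous]).  Goodness at level [j] is a closed
    condition on [x], because [f] and the [h i] are continuous in [x].  Hence
    in a Baire space the points lying in the interior of some set of good points
    form a dense open set ([baire_closed_cover]).  Near such a point [x0], the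
    joint continuity of [h 0], ..., [h j] makes [(x, y)] and [(x, y0)]
    indistinguishable at level [j], so [f (x, y)] is [e]-close to [f (x, y0)],
    which in turn is close to [f (x0, y0)] by continuity in [x].  Intersecting
    over [e = 1 / (m + 1)] gives the dense G-delta set of the Namioka
    property. *)

Import Order.TTheory GRing.Theory Num.Theory.
Import numFieldNormedType.Exports.

Local Open Scope classical_set_scope.
Local Open Scope ring_scope.

Definition determined_by {R : realType} {P : Type} (h : nat -> P -> R)
    (f : P -> R) : Prop :=
  forall p q, (forall n, h n p = h n q) -> f p = f q.

Lemma baire_class_determined (R : realType) (P : topologicalType)
    (d : Order.disp_t) (W : orderType d) (a : W) (f : P -> R) :
  baire_class a f ->
  exists2 h : nat -> P -> R, forall n, continuous (h n) & determined_by h f.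
Proof.
elim=> {a f} [a f _ cf | a f b g _ _ IH fg].
  by exists (fun=> f) => // p q /(_ 0%N).
have /choice[H HP] : forall n, exists h : nat -> P -> R,
    (forall m, continuous (h m)) /\ determined_by h (g n).
  by move=> n; have [h ? ?] := IH n; exists h.
pose index (k : nat) : nat * nat := odflt (0%N, 0%N) (unpickle k).
exists (fun k => H (index k).1 (index k).2) => [k | p q Hpq].
  exact: (HP _).1.
(* Decoding the code of [(n, m)] recovers each [H n m] from the single family. *)
have gpq n : g n p = g n q.
  by apply: (HP n).2 => m; have := Hpq (pickle (n, m)); rewrite /index pickleK.
have fp : (fun n => g n q) @ \oo --> f p.
  by under eq_fun do rewrite -gpq; exact: fg.
exact: (cvg_unique (@norm_hausdorff _ _) fp (fg q)).
Qed.

Lemma baire_measurable_determined (R : realType) (P : topologicalType)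
    (f : P -> R) :
  baire_measurable f ->
  exists2 h : nat -> P -> R, forall n, continuous (h n) & determined_by h f.
Proof. by move=> [d [W [a [_ _]]]]; exact: baire_class_determined. Qed.

(** The set [(F n)° `|` ~` F n] is open and dense for closed [F n]: its
    complement is the boundary of [F n].  A point in all of these sets lies in
    the interior of whichever [F n] contains it. *)
Lemma baire_closed_cover (X : topologicalType) (F : nat -> set X) :
  baire_space X -> (forall n, closed (F n)) -> (forall x, exists n, F n x) ->
  dense (\bigcup_n (F n)°).
Proof.
move=> baireX clF covF O O0 oO.
have [|x [Ox Wx]] := baireX (fun n => (F n)° `|` ~` F n) _ O O0 oO.
  move=> n; split; first by apply: openU; [exact: open_interior|rewrite openC].
  move=> V [x Vx] oV.
  have [VF|/existsNP[z /not_implyP[Vz Fz]]] := pselect (V `<=` F n).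
    by exists x; split => //; left; apply: filterS VF _; exact: open_nbhs_nbhs.
  by exists z; split => //; right.
have [n Fx] := covF x.
by exists x; split => //; exists n => //; case: (Wx n I).
Qed.

Lemma continuous_pairr (X Y : topologicalType) (y : Y) :
  continuous (fun x : X => (x, y)).
Proof. by move=> x; exact: (cvg_pair (@cvg_id _ (nbhs x)) (cvg_cst y)). Qed.

Lemma continuous_pairl (X Y : topologicalType) (x : X) :
  continuous (fun y : Y => (x, y)).
Proof. by move=> y; exact: (cvg_pair (cvg_cst x) (@cvg_id _ (nbhs y))). Qed.

(** If the conclusion fails at every level, the pairs that witness this cluster,
    by compactness of [Y * Y], at a pair on which all [h i] agree but [f]
    differs by at least [e]. *)
Lemma compact_determined_ucontinuous (R : realType) (Y : topologicalType)
    (h : nat -> Y -> R) (f : Y -> R) (e : R) :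
  compact [set: Y] -> (forall n, continuous (h n)) -> continuous f ->
  determined_by h f -> 0 < e ->
  exists j : nat, forall y y',
    (forall i : 'I_j.+1, `|h i y - h i y'| < j.+1%:R^-1) -> `|f y - f y'| <= e.
Proof.
move=> cY ch cf hf e0; apply: contrapT => /forallNP nP.
have /choice[u uP] : forall j : nat, exists q : Y * Y,
    (forall i : 'I_j.+1, `|h i q.1 - h i q.2| < j.+1%:R^-1) /\
    e < `|f q.1 - f q.2|.
  move=> j; have /existsNP[y /existsNP[y' /not_implyP[hq /negP]]] := nP j.
  by rewrite -ltNge => fq; exists (y, y').
have cdist (g : Y -> R) : continuous g ->
    continuous (fun q : Y * Y => `|g q.1 - g q.2|).
  move=> cg q; apply: cvg_norm; apply: cvgB.
    by apply: continuous_comp; [exact: cvg_fst|exact: cg].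
  by apply: continuous_comp; [exact: cvg_snd|exact: cg].
have cYY : compact [set: Y * Y] by rewrite -setXTT; exact: compact_setX.
have [|q [_]] := cYY (u @ \oo) _ _; first exact: filterT.
rewrite clusterE => clq.
have limq (C : set (Y * Y)) : closed C -> (\forall n \near \oo, C (u n)) -> C q.
  by move=> clC uC; rewrite (closure_id C).1//; exact: clq.
have hq i : h i q.1 = h i q.2.
  apply/eqP; rewrite -subr_eq0 -normr_le0.
  apply/ler_addgt0Pr => c c0; rewrite add0r.
  apply: (limq [set q | `|h i q.1 - h i q.2| <= c]).
    apply: (@closed_comp _ _ (fun q : Y * Y => `|h i q.1 - h i q.2|)
      [set r | r <= c]).
      by move=> ? _; exact: cdist.
    exact: closed_le.
  near=> n; have lein : (i < n.+1)%N by near: n; exact: nbhs_infty_ge.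
  apply: ltW; apply: lt_trans ((uP n).1 (Ordinal lein)) _.
  by near: n; exact: (near_infty_natSinv_lt (PosNum c0)).
(* The strict bounds satisfied by the [u n] survive only weakly in the limit. *)
have : e <= `|f q.1 - f q.2|.
  apply: (limq [set q | e <= `|f q.1 - f q.2|]).
    apply: (@closed_comp _ _ (fun q : Y * Y => `|f q.1 - f q.2|)
      [set r | e <= r]).
      by move=> ? _; exact: cdist.
    exact: closed_ge.
  by near=> n; apply/ltW/(uP n).2.
by rewrite (hf _ _ hq) subrr normr0 leNgt e0.
Unshelve. all: by end_near. Qed.

Section FiberOscillation.
Context {R : realType} {X Y : topologicalType}.
Variables (h : nat -> X * Y -> R) (f : X * Y -> R).

(** The points good at level [j].  The hypothesis is a strict inequality and the
    conclusion a weak one in order that the set be closed. *)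
Definition fiber_controlled (e : R) (j : nat) : set X :=
  [set x | forall y y',
    (forall i : 'I_j.+1, `|h i (x, y) - h i (x, y')| < j.+1%:R^-1) ->
    `|f (x, y) - f (x, y')| <= e].

Lemma closed_fiber_controlled (e : R) (j : nat) :
  (forall i y, continuous (fun x => h i (x, y))) ->
  (forall y, continuous (fun x => f (x, y))) ->
  closed (fiber_controlled e j).
Proof.
move=> ch cf; rewrite -openC openE => x.
move=> /existsNP[y /existsNP[y' /not_implyP[hx /negP]]]; rewrite -ltNge => fx.
have cdist (g : X * Y -> R) : (forall y, continuous (fun x => g (x, y))) ->
    `|g (z, y) - g (z, y')| @[z --> x] --> `|g (x, y) - g (x, y')|.
  by move=> cg; apply: cvg_norm; apply: cvgB; exact: cg.
have nh : \forall z \near x,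
    forall i : 'I_j.+1, `|h i (z, y) - h i (z, y')| < j.+1%:R^-1.
  by apply: filter_forall => i; exact: (cvgr_lt _ (cdist _ (ch i))).
have nf : \forall z \near x, e < `|f (z, y) - f (z, y')|.
  exact: (cvgr_gt _ (cdist _ cf)).
rewrite /interior; near=> z => /(_ y y')/=.
rewrite leNgt; have -> /= : e < `|f (z, y) - f (z, y')| by near: z.
by move=> cz; have : false by apply: cz; near: z.
Unshelve. all: by end_near. Qed.

(** Goodness is used at the varying point [p.1] rather than at [x0]: the [h i],
    being jointly continuous, are close to [h i (x0, y0)] both at [p] and at
    [(p.1, y0)], hence close to each other along the fiber over [p.1]. *)
Lemma interior_fiber_controlled_near (e : R) (j : nat) (x0 : X) (y0 : Y) :
  (forall n, continuous (h n)) -> (forall y, continuous (fun x => f (x, y))) ->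
  0 < e -> (fiber_controlled e j)° x0 ->
  \forall p \near (x0, y0), `|f (x0, y0) - f p| < e *+ 2.
Proof.
move=> ch cf e0 cx0.
have d0 : (0 : R) < j.+1%:R^-1 / 2 by rewrite divr_gt0// invr_gt0.
have FF : Filter (nbhs (x0, y0)) by exact: nbhs_filter.
have near_fst (Q : X -> Prop) : (\forall x \near x0, Q x) ->
    \forall p \near (x0, y0), Q p.1.
  by move=> Qx; exact: (@cvg_fst _ _ (nbhs x0) (nbhs y0)).
have nh : \forall p \near (x0, y0),
    forall i : 'I_j.+1, `|h i (x0, y0) - h i p| < j.+1%:R^-1 / 2.
  by apply: (filter_forall FF) => i; apply: cvgr_dist_lt => //; exact: ch.
have nh0 : \forall p \near (x0, y0),
    forall i : 'I_j.+1, `|h i (x0, y0) - h i (p.1, y0)| < j.+1%:R^-1 / 2.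
  apply: (near_fst (fun x =>
    forall i : 'I_j.+1, `|h i (x0, y0) - h i (x, y0)| < _)).
  apply: filter_forall => i; apply: cvgr_dist_lt => //.
  apply: (@continuous_comp _ _ _ (fun x => (x, y0)) (h i)); last exact: ch.
  exact: continuous_pairr.
have nf : \forall p \near (x0, y0), `|f (x0, y0) - f (p.1, y0)| < e.
  apply: (near_fst (fun x => `|f (x0, y0) - f (x, y0)| < e)).
  by apply: cvgr_dist_lt => //; exact: cf.
have nx : \forall p \near (x0, y0), fiber_controlled e j p.1 by exact: near_fst.
apply: filterS (filterI (filterI nh nh0) (filterI nf nx)).
move=> [x y] [[/= hxy hx] [/= fx cx]].
have : `|f (x, y) - f (x, y0)| <= e.
  apply: cx => i; move: (hxy i) (hx i); rewrite !ltr_norml.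
  by move: (j.+1%:R^-1) => d; lra.
by move: fx; rewrite !ltr_norml ler_norml; lra.
Qed.

End FiberOscillation.

(** For each [e = 1 / (m + 1)], compactness makes the good sets of levels
    [j = 0, 1, ...] a countable closed cover of [X], to which Baire category
    applies; joint continuity holds wherever all scales are controlled. *)
Lemma determined_namioka_property (R : realType) (X Y : topologicalType)
    (h : nat -> X * Y -> R) (f : X * Y -> R) :
  baire_space X -> compact [set: Y] -> separately_continuous f ->
  (forall n, continuous (h n)) -> determined_by h f -> namioka_property f.
Proof.
move=> baireX cY [cfy cfx] ch hf.
pose G (m : nat) := \bigcup_j (fiber_controlled h f m.+1%:R^-1 j)°.
have oG m : open (G m) by apply: bigcup_open => j _; exact: open_interior.
have dG m : dense (G m).
  apply: baire_closed_cover => // [j | x].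
    apply: closed_fiber_controlled => // i y x.
    apply: (@continuous_comp _ _ _ (fun x => (x, y)) (h i)); last exact: ch.
    exact: continuous_pairr.
  apply: (@compact_determined_ucontinuous _ _ (fun i y => h i (x, y))
    (fun y => f (x, y))) => // [n y | y y' hyy'].
    apply: (@continuous_comp _ _ _ (fun y => (x, y)) (h n)); last exact: ch.
    exact: continuous_pairl.
  exact: hf.
exists (\bigcap_m G m); split; [exact: baireX | by exists G |].
move=> x y Gx; apply/cvgrPdist_lt => e e0.
have e20 : 0 < e / 2 by rewrite divr_gt0.
have [m _ /(_ m (leqnn m)) /= me] := near_infty_natSinv_lt (PosNum e20).
have [j _ jx] := Gx m I.
have := @interior_fiber_controlled_near _ _ _ h f _ j x y ch cfx _ jx.
rewrite invr_gt0 ltr0n => /(_ isT); apply: filterS => p /lt_trans; apply.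
by move: me; move: (m.+1%:R^-1) => c; rewrite -mulr_natr; lra.
Qed.

Theorem corollary5p4 (R : realType) (X : topologicalType) :
  baire_space X -> weakly_moran R X -> namioka_space R X.
Proof.
move=> baireX moranX Y cY f cf.
have [h ch hf] := baire_measurable_determined _ _ _ (moranX Y cY f cf).
exact: determined_namioka_property cf ch hf.
Qed.
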